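(* Let $X$ be a completely regular space with a replete admissible family $\mathcal{O}$ of open coverings, let $S$ be a topological semigroup acting on $X$ with every map $\mu_s:X\to X$ continuous, and let $\mathcal{F}$ be a filter basis on the subsets of $S$. Assume that: (i) the limit set $\omega(Y,\mathcal{F})$ is invariant for every bounded subset $Y$ of $X$; (ii) for all $s\in S$ and $A\in\mathcal{F}$ there exists $B\in\mathcal{F}$ with $B\subset As$, and for all $s\in S$ and $A\in\mathcal{F}$ there exists $B\in\mathcal{F}$ with $B\subset sA$; (iii) the semigroup action $(S,X)$ is eventually compact, $\mathcal{F}$-eventually bounded, and $\mathcal{F}$-point dissipative. Then $(S,X)$ has a global $\mathcal{F}$-attractor.
   Context: Coverings. For coverings $\mathcal{U},\mathcal{V}$ of $X$: $\mathcal{V}\leqslant\mathcal{U}$ means $\mathcal{V}$ refines $\mathcal{U}$ (each member of $\mathcal{V}$ is contained in some member of $\mathcal{U}$); $\mathcal{V}\leqslant\frac12\mathcal{U}$ means that for all $V,V'\in\mathcal{V}$ with $V\cap V'\neq\emptyset$ there is $U\in\mathcal{U}$ with $V\cup V'\subset U$. The star of $Y\subset X$ is $\mathrm{St}[Y,\mathcal{U}]=\bigcup\{U\in\mathcal{U}:Y\cap U\neq\emptyset\}$, and $\mathrm{St}[x,\mathcal{U}]=\mathrm{St}[\{x\},\mathcal{U}]$. A family $\mathcal{O}$ of open coverings of $X$ is admissible if: (1) for each $\mathcal{U}\in\mathcal{O}$ there is $\mathcal{V}\in\mathcal{O}$ with $\mathcal{V}\leqslant\frac12\mathcal{U}$;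 (2) if $Y\subset X$ is open and $K\subset Y$ is compact, there is $\mathcal{U}\in\mathcal{O}$ with $\mathrm{St}[K,\mathcal{U}]\subset Y$; (3) for $\mathcal{U},\mathcal{V}\in\mathcal{O}$ there is $\mathcal{W}\in\mathcal{O}$ with $\mathcal{W}\leqslant\mathcal{U}$ and $\mathcal{W}\leqslant\mathcal{V}$. It is replete if moreover $X=\bigcup_{\mathcal{U}\in\mathcal{O}}\mathrm{St}[x,\mathcal{U}]$ for every $x\in X$, and for $\mathcal{U},\mathcal{V}\in\mathcal{O}$ there is $\mathcal{W}\in\mathcal{O}$ with $\mathcal{U}\leqslant\frac12\mathcal{W}$ and $\mathcal{V}\leqslant\frac12\mathcal{W}$. (Completely regular spaces are not assumed Hausdorff.) A nonempty $Y\subset X$ is bounded if there is $\mathcal{U}\in\mathcal{O}$ with $y\in\mathrm{St}[x,\mathcal{U}]$ for all $x,y\in Y$. Actions. An action of $S$ on $X$ is a map $\mu:S\times X\to X$, $\mu(s,x)=sx$, with $s(tx)=(st)x$; $\mu_s(x)=sx$. For $A\subset S$, $Y\subset X$, $AY=\bigcup_{s\in A}\mu_s(Y)$. $Y$ is invariant if $sY=Y$ for every $s\in S$. A filter basis $\mathcal{F}$ on the subsets of $S$ is a nonempty family of subsets with $\emptyset\notin\mathcal{F}$ and such that for $A,B\in\mathcal{F}$ there is $C\in\mathcal{F}$ with $C\subset A\cap B$. The $\omega$-limit set is $\omega(Y,\mathcal{F})=\bigcap_{A\in\mathcal{F}}\mathrm{cls}(AY)$. $Y\subset X$ attracts $Z\subset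 X$ if for each $\mathcal{U}\in\mathcal{O}$ there is $A\in\mathcal{F}$ with $AZ\subset\mathrm{St}[Y,\mathcal{U}]$; $Y$ absorbs $Z$ if there is $A\in\mathcal{F}$ with $AZ\subset Y$. $(S,X)$ is: eventually compact if there is $t\in S$ such that $\mu_t(Y)$ is relatively compact (has compact closure) for every bounded $Y\subset X$; $\mathcal{F}$-eventually bounded if for each bounded $Y\subset X$ there is $A\in\mathcal{F}$ with $AY$ bounded; $\mathcal{F}$-point dissipative if there is a bounded $D\subset X$ that absorbs every point $x\in X$ (i.e. every $\{x\}$). A global $\mathcal{F}$-attractor is a subset $\mathcal{A}\subset X$ that is nonempty, closed, compact, invariant, and attracts every bounded subset of $X$. *)

(* Defs.v *)
From HB Require Import structures.
From mathcomp Require Import all_boot.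
From mathcomp Require Import all_classical topology normedtype.

Set Implicit Arguments.
Unset Strict Implicit.
Unset Printing Implicit Defensive.

Local Open Scope classical_set_scope.

(* No unit and no separation axiom are required. *)
HB.mixin Record Semigroup_isTopological S
    of Semigroup S & Topological S := {
  semigroup_mul_continuous : continuous (fun p : S * S => (p.1 * p.2)%g)
}.

#[short(type="topologicalSemigroupType")]
HB.structure Definition TopologicalSemigroup :=
  {S of Semigroup S & Topological S & Semigroup_isTopological S}.

Definition refines {X : Type} (V U : set (set X)) : Prop :=
  forall A, V A -> exists2 B, U B & A `<=` B.

Definition half_refines {X : Type} (V U : set (set X)) : Prop :=
  forall A A', V A -> V A' -> A `&` A' !=set0 ->
    exists2 B, U B & A `|` A' `<=` B.

Definition star {X : Type} (Y : set X) (U : set (set X)) : set X :=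
  \bigcup_(A in [set A | U A /\ Y `&` A !=set0]) A.

Definition open_covering {X : topologicalType} (U : set (set X)) : Prop :=
  (forall A, U A -> open A) /\ cover U id = setT.

Record admissible {X : topologicalType} (O : set (set (set X))) : Prop := {
  admissible_open_covering : forall U, O U -> open_covering U;
  admissible_half : forall U, O U -> exists2 V, O V & half_refines V U;
  admissible_star : forall Y K : set X, open Y -> compact K -> K `<=` Y ->
    exists2 U, O U & star K U `<=` Y;
  admissible_directed : forall U V, O U -> O V ->
    exists W, [/\ O W, refines W U & refines W V]
}.

Record replete_admissible {X : topologicalType}
    (O : set (set (set X))) : Prop := {
  replete_is_admissible : admissible O;
  replete_exhaustive : forall x : X, setT = \bigcup_(U in O) star [set x] U;
  replete_coarser : forall U V, O U -> O V ->
    exists W, [/\ O W, half_refines U W & half_refines V W]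
}.

(* Bounded sets are nonempty by definition. *)
Definition cov_bounded {X : Type} (O : set (set (set X))) (Y : set X) : Prop :=
  Y !=set0 /\
  exists2 U, O U & forall x y, Y x -> Y y -> star [set x] U y.

Definition filter_basis {S : Type} (F : set (set S)) : Prop :=
  [/\ F !=set0, ~ F set0 &
      forall A B, F A -> F B -> exists2 C, F C & C `<=` A `&` B].

Definition semigroup_action {S : semigroupType} {X : Type}
    (mu : S -> X -> X) : Prop :=
  forall s t x, mu s (mu t x) = mu (s * t)%g x.

Definition act_set {S X : Type} (mu : S -> X -> X)
    (A : set S) (Y : set X) : set X :=
  \bigcup_(s in A) (mu s @` Y).

Definition invariant_set {S X : Type} (mu : S -> X -> X) (Y : set X) : Prop :=
  forall s, mu s @` Y = Y.

Definition omega_limit {S : Type} {X : topologicalType} (mu : S -> X -> X)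
    (F : set (set S)) (Y : set X) : set X :=
  \bigcap_(A in F) closure (act_set mu A Y).

Definition attracts {S X : Type} (mu : S -> X -> X) (F : set (set S))
    (O : set (set (set X))) (Y Z : set X) : Prop :=
  forall U, O U -> exists2 A, F A & act_set mu A Z `<=` star Y U.

Definition absorbs {S X : Type} (mu : S -> X -> X) (F : set (set S))
    (Y Z : set X) : Prop :=
  exists2 A, F A & act_set mu A Z `<=` Y.

Definition eventually_compact {S : Type} {X : topologicalType}
    (mu : S -> X -> X) (O : set (set (set X))) : Prop :=
  exists t, forall Y, cov_bounded O Y -> compact (closure (mu t @` Y)).

Definition eventually_bounded {S X : Type} (mu : S -> X -> X)
    (F : set (set S)) (O : set (set (set X))) : Prop :=
  forall Y, cov_bounded O Y -> exists2 A, F A & cov_bounded O (act_set mu A Y).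

Definition point_dissipative {S X : Type} (mu : S -> X -> X)
    (F : set (set S)) (O : set (set (set X))) : Prop :=
  exists2 D, cov_bounded O D & forall x : X, absorbs mu F D [set x].

Record global_attractor {S : Type} {X : topologicalType} (mu : S -> X -> X)
    (F : set (set S)) (O : set (set (set X))) (A : set X) : Prop := {
  attractor_nonempty : A !=set0;
  attractor_closed : closed A;
  attractor_compact : compact A;
  attractor_invariant : invariant_set mu A;
  attractor_attracts : forall Y, cov_bounded O Y -> attracts mu F O A Y
}.

(* Main.v *)
(**
Some [s] moves a neighbourhood of any given point into an open bounded
neighbourhood [D1] of the point-absorbing set, so the bounded set [A D1]
provided by eventual boundedness absorbs a neighbourhood of every point, hence
every compact set. Since the action eventually maps each bounded set into a
compact one, [A D1] absorbs every bounded set, and its omega-limit set is the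
attractor.
*)
Require Import Defs.
From HB Require Import structures.
From mathcomp Require Import all_boot.
From mathcomp Require Import all_classical topology normedtype.

Local Open Scope classical_set_scope.

Set Implicit Arguments.
Unset Strict Implicit.
Unset Printing Implicit Defensive.

Lemma star_open (X : topologicalType) (Y : set X) (U : set (set X)) :
  open_covering U -> open (star Y U).
Proof. by move=> [Uo _]; apply: bigcup_open => A [/Uo]. Qed.

Lemma sub_star (X : topologicalType) (Y : set X) (U : set (set X)) :
  open_covering U -> Y `<=` star Y U.
Proof.
move=> [_ Uc] y Yy; have : cover U id y by rewrite Uc.
by move=> [A UA Ay]; exists A => //; split=> //; exists y.
Qed.

(** The star of [D] in a covering [U] witnessing its boundedness works: two of its points are joined
    by a chain of three successively meeting members of [U], and coarsening twice by repleteness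
    puts the whole chain inside one member. *)
Lemma cov_bounded_open_sup (X : topologicalType) (O : set (set (set X)))
    (D : set X) :
  replete_admissible O -> cov_bounded O D ->
  exists D1, [/\ open D1, D `<=` D1 & cov_bounded O D1].
Proof.
move=> HO [[d Dd] [U OU Ubd]].
have Ucov := admissible_open_covering (replete_is_admissible HO) OU.
exists (star D U); split; [exact: star_open|exact: sub_star|].
split; first by exists d; exact: sub_star.
have [W [OW UW _]] := replete_coarser HO OU OU.
have [W' [OW' WW' _]] := replete_coarser HO OW OW.
exists W' => // y1 y2 [A1 [UA1 [d1 [Dd1 A1d1]]] A1y1] [A2 [UA2 [d2 [Dd2 A2d2]]] A2y2].
have [A3 [UA3 [_ [-> A3d1]]] A3d2] := Ubd _ _ Dd1 Dd2.
have [W1 WW1 sW1] : exists2 B, W B & A1 `|` A3 `<=` B.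
  by apply: UW => //; exists d1.
have [W2 WW2 sW2] : exists2 B, W B & A2 `|` A3 `<=` B.
  by apply: UW => //; exists d2.
have [C WC sC] : exists2 B, W' B & W1 `|` W2 `<=` B.
  by apply: WW' => //; exists d1; split; [apply: sW1|apply: sW2]; right.
exists C; last by apply: sC; right; apply: sW2; left.
by split=> //; exists y1; split=> //; apply: sC; left; apply: sW1; left.
Qed.

Lemma filter_from_basis (S : Type) (F : set (set S)) :
  filter_basis F -> Filter (filter_from F id).
Proof. by move=> [[A FA] _ FI]; apply: filter_from_filter; [exists A|]. Qed.

Lemma filter_basis_nonempty (S : Type) (F : set (set S)) (A : set S) :
  filter_basis F -> F A -> A !=set0.
Proof. by move=> [_ F0 _] FA; apply/set0P/eqP => A0; apply: F0; rewrite -A0. Qed.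

(** Turns absorption into an eventual property along the filter generated by [F], the form to which
    near-covering compactness applies. *)
Lemma absorbsP (S X : Type) (mu : S -> X -> X) (F : set (set S)) (Y Z : set X) :
  absorbs mu F Y Z <-> filter_from F id [set s | forall z, Z z -> Y (mu s z)].
Proof.
split=> -[A FA AZ]; exists A => //.
  by move=> s As z Zz; apply: AZ; exists s => //; exists z.
by move=> _ [s As [z Zz <-]]; exact: AZ.
Qed.

(** A single [s] in [A] already sends [Z] into [Y], so every element of [B * s] sends [Z] into [W],
    and [B * s] contains a member of [F]. *)
Lemma absorbs_trans (S : semigroupType) (X : Type) (mu : S -> X -> X)
    (F : set (set S)) (Z Y W : set X) :
  semigroup_action mu -> filter_basis F ->
  (forall s A, F A -> exists2 B, F B & B `<=` [set (a * s)%g | a in A]) ->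
  absorbs mu F Y Z -> absorbs mu F W Y -> absorbs mu F W Z.
Proof.
move=> act Fb Fr [A FA AZ] [B FB BY].
have [s As] := filter_basis_nonempty Fb FA.
have [C FC CB] := Fr s B FB.
exists C => // _ [c /CB[b Bb <-] [z Zz <-]].
rewrite -act; apply: BY; exists b => //; exists (mu s z) => //.
by apply: AZ; exists s => //; exists z.
Qed.

(** Finitely many of the neighbourhoods cover [K], and the corresponding members of [F] have a
    common refinement in [F]; the near-covering form of compactness packages both steps. *)
Lemma absorbs_compact (S : Type) (X : topologicalType) (mu : S -> X -> X)
    (F : set (set S)) (E K : set X) :
  filter_basis F -> compact K ->
  (forall x, K x -> exists2 N, nbhs x N & absorbs mu F E N) ->
  absorbs mu F E K.
Proof.
move=> Fb /compact_near_coveringP Kc EN; apply/absorbsP.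
apply: (Kc S _ (fun s x => E (mu s x)) (filter_from_basis Fb)) => x Kx.
have [N xN [A FA AN]] := EN x Kx.
exists (N, A) => /=; first by split=> //; exists A.
by move=> [y s] [/= Ny As]; apply: AN; exists s => //; exists y.
Qed.

Lemma omega_limit_closed (S : Type) (X : topologicalType) (mu : S -> X -> X)
    (F : set (set S)) (Y : set X) : closed (omega_limit mu F Y).
Proof. by apply: closed_bigI => A _; exact: closed_closure. Qed.

Lemma omega_limit_compact (S : Type) (X : topologicalType) (mu : S -> X -> X)
    (F : set (set S)) (Y K : set X) :
  closed K -> compact K -> absorbs mu F K Y -> compact (omega_limit mu F Y).
Proof.
move=> Kcl Kc [A FA AY].
apply: (subclosed_compact _ Kc); first exact: omega_limit_closed.
by move=> x /(_ A FA) /(closureS AY); apply: Kcl.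
Qed.

(** A point of [K] outside [V] is not a limit point, so some [act_set mu A Y] misses a neighbourhood
    of it. Compactness of [K] makes this uniform. *)
Lemma omega_limit_absorbs (S : Type) (X : topologicalType) (mu : S -> X -> X)
    (F : set (set S)) (Y K V : set X) :
  filter_basis F -> compact K -> absorbs mu F K Y ->
  open V -> omega_limit mu F Y `<=` V -> absorbs mu F V Y.
Proof.
move=> Fb /compact_near_coveringP Kc /absorbsP KY Vo wV; apply/absorbsP.
have FF := filter_from_basis Fb.
(* Eventually, every point of [K] hit by [mu s] from [Y] lies in [V]; away from [V] this holds
   vacuously, because nearby points are not hit. *)
have : \forall s \near filter_from F id,
    K `<=` (fun x => forall y, Y y -> mu s y = x -> V x).
  apply: Kc => x Kx; have [Vx|nVx] := pselect (V x).
    exists (V, setT) => /=; last by move=> [x' s] [].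
    by split; [exact: open_nbhs_nbhs|exact: filterT].
  have [A FA xA] : exists2 A, F A & ~ closure (act_set mu A Y) x.
    apply: contrapT => nA; apply/nVx/wV => A FA.
    by apply: contrapT => xA; apply: nA; exists A.
  exists (~` closure (act_set mu A Y), A) => /=.
    split; last by exists A.
    by apply: open_nbhs_nbhs; split=> //; apply/closed_openC/closed_closure.
  move=> [x' s] [/= nx' As] y Yy yx'; case: nx'.
  by apply: subset_closure; exists s => //; exists y.
by apply: filterS2 KY => s KY KV y Yy; apply: (KV (mu s y) (KY y Yy) y).
Qed.

(** Were the limit set empty, the open set [set0] would absorb the nonempty [Y]. *)
Lemma omega_limit_nonempty (S : Type) (X : topologicalType) (mu : S -> X -> X)
    (F : set (set S)) (Y K : set X) :
  filter_basis F -> compact K -> absorbs mu F K Y -> Y !=set0 ->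
  omega_limit mu F Y !=set0.
Proof.
move=> Fb Kc KY [y Yy]; apply/set0P/eqP => w0.
have [|A FA A0] := omega_limit_absorbs Fb Kc KY open0; first by rewrite w0.
have [s As] := filter_basis_nonempty Fb FA.
by apply: (A0 (mu s y)); exists s => //; exists y.
Qed.

Lemma bounded_absorbed_compact (X : topologicalType) (O : set (set (set X)))
    (S : semigroupType) (mu : S -> X -> X) (F : set (set S)) (Y : set X) :
  semigroup_action mu ->
  (forall s A, F A -> exists2 B, F B & B `<=` [set (s * a)%g | a in A]) ->
  eventually_compact mu O -> eventually_bounded mu F O -> cov_bounded O Y ->
  exists K, [/\ closed K, compact K & absorbs mu F K Y].
Proof.
move=> act Fl [t tc] eb Yb; have [A FA AYb] := eb Y Yb.
exists (closure (mu t @` act_set mu A Y)).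
split; [exact: closed_closure|exact: tc|].
(* The left translate [t * A] sends [Y] into the image under [mu t] of the bounded set
   [act_set mu A Y]. *)
have [B FB BA] := Fl t A FA; exists B => // _ [b /BA[a Aa <-] [y Yy <-]].
apply: subset_closure; exists (mu a y); last by rewrite act.
by exists a => //; exists y.
Qed.

Lemma bounded_absorbs_nbhs (X : topologicalType) (O : set (set (set X)))
    (S : semigroupType) (mu : S -> X -> X) (F : set (set S)) :
  replete_admissible O -> semigroup_action mu ->
  (forall s, continuous (mu s)) -> filter_basis F ->
  (forall s A, F A -> exists2 B, F B & B `<=` [set (a * s)%g | a in A]) ->
  eventually_bounded mu F O -> point_dissipative mu F O ->
  exists2 E, cov_bounded O E &
    forall x : X, exists2 N, nbhs x N & absorbs mu F E N.
Proof.
move=> HO act muc Fb Fr eb [D Db Dabs].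
have [D1 [D1o DD1 D1b]] := cov_bounded_open_sup HO Db.
have [A FA AD1b] := eb D1 D1b.
exists (act_set mu A D1) => // x.
have [B FB Bx] := Dabs x; have [s Bs] := filter_basis_nonempty Fb FB.
(* This neighbourhood of [x] is sent into [D1] by [s], hence into [act_set mu A D1] by [A * s]. *)
exists (mu s @^-1` D1).
  apply/muc/open_nbhs_nbhs; split=> //; apply/DD1/Bx.
  by exists s => //; exists x.
have [C FC CA] := Fr s A FA; exists C => // _ [c /CA[a Aa <-] [y Dy <-]].
by rewrite -act; exists a => //; exists (mu s y).
Qed.

Theorem theorem5 (X : topologicalType) (O : set (set (set X)))
    (S : topologicalSemigroupType) (mu : S -> X -> X) (F : set (set S))
    (X_cr : completely_regular_space X)
    (O_replete : replete_admissible O)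
    (mu_action : semigroup_action mu)
    (mu_continuous : forall s : S, continuous (mu s))
    (F_basis : filter_basis F)
    (omega_invariant : forall Y : set X, cov_bounded O Y ->
       invariant_set mu (omega_limit mu F Y))
    (F_right : forall (s : S) (A : set S), F A ->
       exists2 B : set S, F B & B `<=` [set (a * s)%g | a in A])
    (F_left : forall (s : S) (A : set S), F A ->
       exists2 B : set S, F B & B `<=` [set (s * a)%g | a in A])
    (mu_ev_compact : eventually_compact mu O)
    (mu_ev_bounded : eventually_bounded mu F O)
    (mu_pt_dissipative : point_dissipative mu F O) :
  exists A : set X, global_attractor mu F O A.
Proof.
have [E Eb EN] := bounded_absorbs_nbhs O_replete mu_action mu_continuous F_basis
  F_right mu_ev_bounded mu_pt_dissipative.
have into_compact Y := @bounded_absorbed_compact _ _ _ _ _ Y mu_action F_left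
  mu_ev_compact mu_ev_bounded.
have [K [Kcl Kc KE]] := into_compact E Eb.
exists (omega_limit mu F E); split.
- exact: (omega_limit_nonempty F_basis Kc KE (proj1 Eb)).
- exact: omega_limit_closed.
- exact: (omega_limit_compact Kcl Kc KE).
- exact: omega_invariant.
(* Absorption is chained: [Y] into the compact [L], [L] into [E], and [E] into the star of its limit
   set, an open neighbourhood of that set. *)
- move=> Y /into_compact[L [_ Lc LY]] U OU.
  have EL : absorbs mu F E L by apply: absorbs_compact.
  have EY := absorbs_trans mu_action F_basis F_right LY EL.
  apply: (absorbs_trans mu_action F_basis F_right EY).
  have Ucov := admissible_open_covering (replete_is_admissible O_replete) OU.
  by apply: (omega_limit_absorbs F_basis Kc KE); [exact: star_open|exact: sub_star].
Qed.
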